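(* Let $(X,d)$ be a nonempty ultrametric space. Then the following statements are equivalent: (i) $(X,d)$ is weakly similar to an unbounded ultrametric space. (ii) The poset $(D(X,d),\leqslant)$ does not have a largest element.
   Context: $\mathbb{R}^{+}=[0,\infty)$. An ultrametric on a set $X$ is a metric $d\colon X\times X\to\mathbb{R}^{+}$ satisfying $d(x,y)\le\max\{d(x,z),d(z,y)\}$ for all $x,y,z\in X$. For a metric space $(X,d)$, the distance set is $D(X,d)=\{d(x,y)\colon x,y\in X\}$; the space is bounded if $\sup D(X,d)<\infty$ and unbounded otherwise. For nonempty metric spaces $(X,d)$ and $(Y,\rho)$, a mapping $\Phi\colon X\to Y$ is a weak similarity of $(X,d)$ and $(Y,\rho)$ if $\Phi$ is bijective and there is a strictly increasing function $\psi\colon D(Y,\rho)\to D(X,d)$ such that $d(x,y)=\psi(\rho(\Phi(x),\Phi(y)))$ for all $x,y\in X$. The spaces $(X,d)$ and $(Y,\rho)$ are weakly similar if such a weak similarity exists. *)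

(* Defs.v *)
From Stdlib Require Import Reals FinFun.
Open Scope R_scope.

Definition is_ultrametric (X : Metric_Space) : Prop :=
  forall x y z : Base X, dist X x y <= Rmax (dist X x z) (dist X z y).

Definition distance_set (X : Metric_Space) : R -> Prop :=
  fun r => exists x y : Base X, r = dist X x y.

Definition unbounded (X : Metric_Space) : Prop := ~ bound (distance_set X).

Definition has_largest_element (E : R -> Prop) : Prop :=
  exists m : R, E m /\ is_upper_bound E m.

Definition strictly_increasing_on (A B : R -> Prop)
    (psi : {r : R | A r} -> {r : R | B r}) : Prop :=
  forall s t : {r : R | A r},
    proj1_sig s < proj1_sig t -> proj1_sig (psi s) < proj1_sig (psi t).

Definition dist_in (X : Metric_Space) (x y : Base X) :
    {r : R | distance_set X r} :=
  exist (distance_set X) (dist X x y)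
    (ex_intro _ x (ex_intro _ y eq_refl)).

Definition weak_similarity (X Y : Metric_Space) (Phi : Base X -> Base Y) :
    Prop :=
  Bijective Phi /\
  exists psi : {r : R | distance_set Y r} -> {r : R | distance_set X r},
    strictly_increasing_on (distance_set Y) (distance_set X) psi /\
    forall x y : Base X,
      dist X x y = proj1_sig (psi (dist_in Y (Phi x) (Phi y))).

Definition weakly_similar (X Y : Metric_Space) : Prop :=
  inhabited (Base X) /\ inhabited (Base Y) /\
  exists Phi : Base X -> Base Y, weak_similarity X Y Phi.

(* Main.v *)
(** If [psi] is strictly increasing and [psi s] is the largest distance of [X],
    then [s] is the largest distance of [Y]; so a space weakly similar to an
    unbounded one has no largest distance.  Conversely, suppose [D(X)] has no
    largest element.  If [X] is unbounded, it is similar to itself; otherwise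
    [S = sup D(X)] is not attained, and replacing the metric [d] by
    [d / (S - d)] keeps it an ultrametric and sends distances close to [S] to
    infinity. *)

Require Import Defs.
From Stdlib Require Import Reals FinFun.
From Stdlib Require Import Lra Classical.
Open Scope R_scope.

Lemma distance_set_0 (X : Metric_Space) :
  inhabited (Base X) -> distance_set X 0.
Proof.
intros [x]; exists x, x; symmetry; now apply dist_refl.
Qed.

Lemma dist_in_distance_set (X : Metric_Space) (x y : Base X) :
  distance_set X (dist X x y).
Proof.
now exists x, y.
Qed.

Lemma strictly_increasing_on_unbounded (A B : R -> Prop)
    (psi : {r : R | A r} -> {r : R | B r}) (s : {r : R | A r}) :
  strictly_increasing_on A B psi -> ~ bound A ->
  ~ is_upper_bound B (proj1_sig (psi s)).
Proof.
intros incr unb ub; apply unb.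
exists (proj1_sig s); intros t At; apply Rnot_lt_le; intros lt_st.
apply (Rle_not_lt _ _ (ub _ (proj2_sig (psi (exist A t At))))).
now apply incr.
Qed.

(** A monotone [f] commutes with maxima, so composing it with the metric preserves the strong
    triangle inequality. All conditions on [f] concern distances only, since [t / (S - t)] behaves
    well only below [S]. The explicit inverse [g] provides [psi]. *)
Lemma ultrametric_rescale (X : Metric_Space) (f g : R -> R) :
  inhabited (Base X) -> is_ultrametric X -> f 0 = 0 ->
  (forall s t, distance_set X s -> distance_set X t -> s < t -> f s < f t) ->
  (forall t, distance_set X t -> g (f t) = t) ->
  exists Y : Metric_Space,
    is_ultrametric Y /\ weakly_similar X Y /\
    (forall t, distance_set X t -> distance_set Y (f t)).
Proof.
intros inhX ultraX f0 f_incr fK.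
assert (D0 := distance_set_0 X inhX).
assert (f_mono : forall s t, distance_set X s -> distance_set X t ->
    s <= t -> f s <= f t).
{ intros s t Ds Dt [lt_st | ->]; [left; auto | lra]. }
set (rho := fun x y : Base X => f (dist X x y)).
assert (rho_pos : forall x y, rho x y >= 0).
{ intros x y; apply Rle_ge; rewrite <- f0.
  apply f_mono; auto using dist_in_distance_set.
  apply Rge_le, dist_pos. }
assert (rho_sym : forall x y, rho x y = rho y x).
{ intros x y; unfold rho; now rewrite dist_sym. }
assert (rho_refl : forall x y, rho x y = 0 <-> x = y).
{ intros x y; rewrite <- (dist_refl X x y); unfold rho; split; intros E.
  - transitivity (g (f 0)); [| now apply fK].
    rewrite f0, <- E; symmetry; apply fK, dist_in_distance_set.
  - now rewrite E. }
assert (rho_ultra : forall x y z, rho x y <= Rmax (rho x z) (rho z y)).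
{ intros x y z; specialize (ultraX x y z); revert ultraX.
  destruct (Rle_dec (dist X x z) (dist X z y)) as [le | gt].
  - rewrite Rmax_right by exact le; intros H.
    apply Rle_trans with (2 := Rmax_r _ _).
    apply f_mono; auto using dist_in_distance_set.
  - rewrite Rmax_left by lra; intros H.
    apply Rle_trans with (2 := Rmax_l _ _).
    apply f_mono; auto using dist_in_distance_set. }
(* The maximum of two nonnegative numbers is at most their sum. *)
assert (rho_tri : forall x y z, rho x y <= rho x z + rho z y).
{ intros x y z; apply (Rle_trans _ _ _ (rho_ultra x y z)).
  assert (pos_xz := rho_pos x z); assert (pos_zy := rho_pos z y).
  apply Rmax_lub; lra. }
set (Y := Build_Metric_Space (Base X) rho rho_pos rho_sym rho_refl rho_tri).
assert (gY : forall r, distance_set Y r ->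
    distance_set X (g r) /\ r = f (g r)).
{ intros r [x [y ->]]; simpl; unfold rho.
  rewrite fK by apply dist_in_distance_set.
  auto using dist_in_distance_set. }
exists Y; split; [exact rho_ultra | split].
- split; [exact inhX | split; [exact inhX |]].
  (* The points stay the same; [psi] is [g] restricted to the distances of [Y], where [gY] makes it
     a two-sided inverse of [f]. *)
  exists (fun x => x); split; [now exists (fun x => x) |].
  exists (fun r => exist (distance_set X) (g (proj1_sig r))
                     (proj1 (gY _ (proj2_sig r)))); split.
  + intros [r Dr] [s Ds]; simpl; intros lt_rs.
    destruct (gY r Dr) as [Dgr Er]; destruct (gY s Ds) as [Dgs Es].
    (* Were [g s <= g r], applying the monotone [f] would give [s <= r]. *)
    apply Rnot_le_lt; intros le_gsr.
    assert (le := f_mono _ _ Dgs Dgr le_gsr); lra.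
  + intros x y; simpl; unfold rho; symmetry.
    apply fK, dist_in_distance_set.
- intros t [x [y ->]]; now exists x, y.
Qed.

Theorem theorem2p6 (X : Metric_Space) (HX : inhabited (Base X))
    (ultraX : is_ultrametric X) :
  (exists Y : Metric_Space,
     is_ultrametric Y /\ unbounded Y /\ weakly_similar X Y)
  <-> ~ has_largest_element (distance_set X).
Proof.
split.
- intros [Y [_ [unbY [_ [_ [Phi [_ [psi [incr E]]]]]]]]] [m [[x [y ->]] ub]].
  (* The largest element is a distance of [X], hence a value of [psi]. *)
  rewrite E in ub.
  exact (strictly_increasing_on_unbounded _ _ _ _ incr unbY ub).
- intros noMax.
  destruct (classic (bound (distance_set X))) as [bdX | unbX].
  + assert (D0 := distance_set_0 X HX).
    destruct (completeness _ bdX (ex_intro _ 0 D0)) as [S [ubS lubS]].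
    assert (lt_S : forall t, distance_set X t -> t < S).
    { intros t Dt; destruct (ubS t Dt) as [lt | ->]; [exact lt |].
      exfalso; apply noMax; now exists S. }
    assert (S_pos := lt_S 0 D0).
    (* Solving [r = t / (S - t)] for [t] gives the inverse [S * r / (1 + r)]. *)
    destruct (ultrametric_rescale X (fun t => t / (S - t))
                (fun r => S * r / (1 + r)) HX ultraX)
      as [Y [ultraY [simXY imY]]].
    * field; lra.
    * intros s t Ds Dt lt_st.
      assert (lt_sS := lt_S s Ds); assert (lt_tS := lt_S t Dt).
      apply Rminus_gt_0_lt.
      replace (t / (S - t) - s / (S - s))
        with (S * (t - s) / ((S - t) * (S - s))) by (field; lra).
      apply Rdiv_lt_0_compat; apply Rmult_lt_0_compat; lra.
    * intros t Dt; assert (lt_tS := lt_S t Dt); field; lra.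
    * exists Y; split; [exact ultraY | split; [| exact simXY]].
      intros [M ubM].
      (* The distance 0 is sent to 0, so [M] bounds 0 and [1 + M] is positive. *)
      assert (M_ge0 : 0 <= M).
      { apply Rle_trans with (0 / (S - 0)); [right; field; lra |].
        now apply ubM, imY. }
      (* [t / (S - t) <= M] means [t <= S * M / (1 + M)], which is below [S]. *)
      assert (le_S : S <= S * M / (1 + M)).
      { apply lubS; intros t Dt; assert (lt_tS := lt_S t Dt).
        assert (le_M := ubM _ (imY t Dt)).
        apply Rmult_le_compat_r with (r := S - t) in le_M; [| lra].
        unfold Rdiv in le_M; rewrite Rmult_assoc, Rinv_l in le_M by lra.
        apply Rmult_le_reg_r with (1 + M); [lra |].
        unfold Rdiv; rewrite (Rmult_assoc (S * M)), Rinv_l by lra; lra. }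
      (* Clearing the denominator leaves [S * (1 + M) <= S * M], against [S > 0]. *)
      apply Rmult_le_compat_r with (r := 1 + M) in le_S; [| lra].
      unfold Rdiv in le_S; rewrite (Rmult_assoc (S * M)), Rinv_l in le_S by lra.
      lra.
  (* Rescaling by the identity yields a copy of [X] with the same distances. *)
  + destruct (ultrametric_rescale X (fun t => t) (fun t => t) HX ultraX)
      as [Y [ultraY [simXY imY]]]; auto.
    exists Y; split; [exact ultraY | split; [| exact simXY]].
    intros [M ubM]; apply unbX; exists M; intros t Dt; auto.
Qed.
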